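(* Let $X$ be an unbounded, locally finite, finite-dimensional CAT(0) cube complex which is essential, strictly non-Euclidean and cocompact. Then $\mathcal U_{NT}(X)$ is a dense $G_\delta$ subset of $B(X)$.
   Context: **Cube complexes.** A CAT(0) cube complex is a simply connected cell complex whose closed cells are Euclidean cubes $[0,1]^n$, such that any two cubes are disjoint or meet in a single face of each, and links of vertices are flag simplicial complexes. A hyperplane $\hat{\mathfrak h}$ is a (connected) subspace meeting each cube in the empty set or in a single midcube; its complement has exactly two components, the half-spaces $\mathfrak h,\mathfrak h^*$. $\mathcal H$ is the set of half-spaces. $\mathrm{Aut}(X)$ is the group of cellular automorphisms; $X$ is cocompact if $\mathrm{Aut}(X)$ acts cocompactly. A half-space is deep if it contains arbitrarily large balls; a hyperplane is essential if both its half-spaces are deep; $X$ is essential if all its hyperplanes are. Every finite-dimensional CAT(0) cube complex is canonically a finite product of irreducible ones (not decomposable as nontrivial products), its irreducible factors. An unbounded cocompact CAT(0) cube complex is Euclidean if it contains an $\mathrm{Aut}(X)$-invariant flat (isometrically embedded Euclidean space), and non-Euclidean otherwise. An unbounded essential CAT(0) cube complex all of whose irreducible factors are non-Euclidean is strictly non-Euclidean. **Ultrafilters.** An ultrafilter is a subset $\alpha\subset\mathcal H$ containing exactly one of $\mathfrak h,\mathfrak h^*$ for each hyperplane, and such that $\mathfrak h\in\alpha$, $\mathfrak h\subset\mathfrak h'$ imply $\mathfrak h'\in\alpha$. $\mathcal U(X)$ is the set of ultrafilters with the topology induced from the product topology on $\prod_{\hat{\mathfrak h}}\{\mathfrak h,\mathfrak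 h^*\}$. An ultrafilter $\alpha$ is nonterminating if for every $\mathfrak h\in\alpha$ there is $\mathfrak h'\in\alpha$ with $\mathfrak h'\subsetneq\mathfrak h$. $\mathcal U_{NT}(X)$ is the set of nonterminating ultrafilters and $B(X)$ is its closure in $\mathcal U(X)$. *)

(* Defs.v *)
From HB Require Import structures.
From mathcomp Require Import all_boot all_order all_algebra.
From mathcomp Require Import all_classical all_reals all_analysis.

Set Implicit Arguments.
Unset Strict Implicit.
Unset Printing Implicit Defensive.

Import Order.TTheory GRing.Theory Num.Theory.
Import numFieldNormedType.Exports.

Local Open Scope classical_set_scope.
Local Open Scope ring_scope.

Section EuclideanCubes.
Variables (R : realType) (n : nat).
Implicit Types u v : 'rV[R]_n.

Definition eucl_dist u v : R := Num.sqrt (\sum_i (u 0 i - v 0 i) ^+ 2).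

Definition unit_cube : set 'rV[R]_n := [set u | forall i, 0 <= u 0 i <= 1].

(* [p i = Some b] fixes the i-th coordinate to b; [p i = None] leaves it free *)
Definition cube_face (p : 'I_n -> option bool) : set 'rV[R]_n :=
  [set u | unit_cube u /\ forall i b, p i = Some b -> u 0 i = b%:R].

Definition midcube (i : 'I_n) : set 'rV[R]_n :=
  [set u | unit_cube u /\ u 0 i = 2^-1].

End EuclideanCubes.
Arguments unit_cube R n : clear implicits.

(* A cell complex (with its weak topology) whose closed cells are isometric
   copies of unit cubes. Only the restriction of [chart c] to the unit cube is
   meaningful. The faces of a cell are cells, a cell is determined by its
   image, and two cells are disjoint or share exactly one face of each, along
   which their Euclidean metrics agree. *)
Record cubeComplex (R : realType) := CubeComplex {
  carrier :> topologicalType;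
  cell : Type;
  dim : cell -> nat;
  chart : forall c : cell, 'rV[R]_(dim c) -> carrier;
  chart_inj : forall c u v, unit_cube R (dim c) u -> unit_cube R (dim c) v ->
    chart u = chart v -> u = v;
  cells_cover : forall x : carrier,
    exists c, (@chart c @` unit_cube R (dim c)) x;
  cell_ext : forall c c',
    @chart c @` unit_cube R (dim c) = @chart c' @` unit_cube R (dim c') ->
    c = c';
  cell_faces : forall c p, exists c',
    @chart c' @` unit_cube R (dim c') = @chart c @` cube_face p;
  cells_meet : forall c c',
    let K := (@chart c @` unit_cube R (dim c))
             `&` (@chart c' @` unit_cube R (dim c')) in
    K = set0 \/
    exists p p', K = @chart c @` cube_face p /\ K = @chart c' @` cube_face p';
  cells_isometric : forall c c' (u v : 'rV_(dim c)) (u' v' : 'rV_(dim c')),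
    unit_cube R (dim c) u -> unit_cube R (dim c) v ->
    unit_cube R (dim c') u' -> unit_cube R (dim c') v' ->
    chart u = chart u' -> chart v = chart v' ->
    eucl_dist u v = eucl_dist u' v';
  weak_topologyE : forall A : set carrier,
    closed A <->
    forall c, closed (unit_cube R (dim c) `&` @chart c @^-1` A)
}.
Arguments cell {R} X : rename.
Arguments dim {R X} c : rename.
Arguments chart {R X} c u : rename.

Section Cells.
Variables (R : realType) (X : cubeComplex R).
Implicit Types (c v e : cell X) (x y : X).

Definition cube c : set X := chart c @` unit_cube R (dim c).

Definition coord c x : 'rV[R]_(dim c) :=
  xget 0 [set u | unit_cube R (dim c) u /\ chart c u = x].

(* meaningful for points of [cube c] only *)
Definition cell_dist c x y : R := eucl_dist (coord c x) (coord c y).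

(* lengths of the piecewise linear paths given by strings of points, each of
   which shares a cell with the next one *)
Inductive string_length : X -> X -> R -> Prop :=
| string_nil x : string_length x x 0
| string_cons c x y z l : cube c x -> cube c y -> string_length y z l ->
    string_length x z (cell_dist c x y + l).

(* the CAT(0) metric, i.e. the length metric induced by the cells *)
Definition cdist x y : R := inf [set l | string_length x y l].

Definition cball x (r : R) : set X := [set y | cdist x y < r].

Definition unbounded := forall r : R, exists x y, r < cdist x y.

Definition finite_dimensional := exists N : nat, forall c, (dim c <= N)%N.

Definition locally_finite := forall x,
  exists2 U : set X, nbhs x U & finite_set [set c | cube c `&` U !=set0].

End Cells.

Section CAT0.
Variable R : realType.

(* The vertices of the link of v are the edges at v, and each cell of positive
   dimension at v contributes the simplex spanned by its edges at v. *)
Section Links.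
Variables (X : cubeComplex R) (v : cell X).

Definition link_vertices : set (cell X) :=
  [set e | dim e = 1%N /\ cube v `<=` cube e].

Definition link_cells : set (cell X) :=
  [set c | (0 < dim c)%N /\ cube v `<=` cube c].

Definition link_simplex (c : cell X) : set (cell X) :=
  [set e | link_vertices e /\ cube e `<=` cube c].

Definition link : set (set (cell X)) := link_simplex @` link_cells.

Definition simplicial_link :=
  [/\ set_inj link_cells link_simplex,
      forall s, link s -> finite_set s /\ s !=set0 &
      forall s t, link s -> t `<=` s -> t !=set0 -> link t].

Definition flag_link := forall s : set (cell X),
  s `<=` link_vertices -> finite_set s -> s !=set0 ->
  (forall e e', s e -> s e' -> e <> e' -> link [set e; e']) ->
  link s.

End Links.

Definition simply_connected (T : topologicalType) :=
  [/\ [set: T] !=set0,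
      forall x y : T, exists g : R -> T,
        [/\ {within `[0, 1], continuous g}, g 0 = x & g 1 = y] &
      forall g : R -> T, {within `[0, 1], continuous g} -> g 0 = g 1 ->
        exists h : R * R -> T,
          [/\ {within `[0, 1] `*` `[0, 1], continuous h},
              forall t : R, 0 <= t <= 1 -> h (t, 0) = g t /\ h (t, 1) = g 0 &
              forall s : R, 0 <= s <= 1 -> h (0, s) = g 0 /\ h (1, s) = g 0]].

Definition CAT0 (X : cubeComplex R) :=
  simply_connected X /\
  forall v : cell X, dim v = 0%N -> simplicial_link v /\ flag_link v.

End CAT0.

Section Automorphisms.
Variables (R : realType) (X : cubeComplex R).

Definition cellular (f : X -> X) := forall c, exists c',
  f @` cube c = cube c' /\
  forall x y, cube c x -> cube c y ->
    cell_dist c' (f x) (f y) = cell_dist c x y.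

Definition automorphism (f : X -> X) := cellular f /\
  exists g : X -> X, [/\ cancel f g, cancel g f & cellular g].

Definition cocompact := exists2 K : set X, compact K &
  forall x, exists f y, [/\ automorphism f, K y & f y = x].

Definition flat n (f : 'rV[R]_n -> X) :=
  forall u v, cdist (f u) (f v) = eucl_dist u v.

(* the terms Euclidean and non-Euclidean are only meant for unbounded cocompact
   CAT(0) cube complexes, such as the irreducible factors of an essential
   cocompact one *)
Definition Euclidean := exists n (f : 'rV[R]_n -> X),
  flat f /\ forall g, automorphism g -> g @` range f = range f.

Definition nonEuclidean := ~ Euclidean.

End Automorphisms.

Section Products.
Variable R : realType.

(* [phi] maps the product of the cells c i isometrically onto the cell d *)
Definition product_cell (I : finType) (Y : I -> cubeComplex R)
    (X : cubeComplex R) (phi : (forall i, Y i) -> X)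
    (c : forall i, cell (Y i)) (d : cell X) :=
  phi @` [set y | forall i, cube (c i) (y i)] = cube d /\
  forall y z, (forall i, cube (c i) (y i)) -> (forall i, cube (c i) (z i)) ->
    cell_dist d (phi y) (phi z) =
    Num.sqrt (\sum_i cell_dist (c i) (y i) (z i) ^+ 2).

Definition is_product (I : finType) (Y : I -> cubeComplex R)
    (X : cubeComplex R) :=
  exists phi : (forall i, Y i) -> X,
    [/\ bijective phi,
        forall c : (forall i, cell (Y i)), exists d, product_cell phi c d &
        forall d : cell X, exists c, product_cell phi c d].

Definition is_point (X : cubeComplex R) := exists x : X, forall y, y = x.

Definition irreducible (X : cubeComplex R) := ~ is_point X /\
  forall Y : bool -> cubeComplex R,
    (forall b, CAT0 (Y b)) -> is_product Y X -> exists b, is_point (Y b).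

Definition irreducible_factor (Y X : cubeComplex R) :=
  exists n (Z : 'I_n -> cubeComplex R),
    [/\ forall i, CAT0 (Z i) /\ irreducible (Z i),
        is_product Z X &
        exists i, Y = Z i].

End Products.

Section HalfSpaces.
Variables (R : realType) (X : cubeComplex R).
Implicit Types (J h : set X) (a : set (set X)).

Definition hyperplanes : set (set X) :=
  [set J | [/\ J !=set0, connected J &
    forall c, cube c `&` J = set0 \/
      exists i, cube c `&` J = chart c @` midcube i]].

Definition sides J : set (set X) :=
  [set connected_component (~` J) x | x in ~` J].

Definition half_spaces : set (set X) := \bigcup_(J in hyperplanes) sides J.

Definition deep h := forall r : R, exists x, cball x r `<=` h.

Definition essential :=
  forall J, hyperplanes J -> forall h, sides J h -> deep h.

Definition strictly_nonEuclidean :=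
  [/\ unbounded X, essential &
      forall Y, irreducible_factor Y X -> nonEuclidean Y].

(* [exists!]: exactly one of the two sides of J *)
Definition ultrafilter a :=
  [/\ a `<=` half_spaces,
      forall J, hyperplanes J -> exists! h, sides J h /\ a h &
      forall h h', a h -> half_spaces h' -> h `<=` h' -> a h'].

Definition ultrafilters : Type := set_type ultrafilter.
HB.instance Definition _ := Choice.on ultrafilters.

Definition chosen_side (a : ultrafilters) J : set X :=
  xget set0 [set h | sides J h /\ set_val a h].

Lemma chosen_side_subproof (a : ultrafilters) (J : hyperplanes) :
  chosen_side a (set_val J) \in sides (set_val J).
Proof.
have [_ + _] := set_valP a.
move=> /(_ _ (set_valP J)) [h [hP _]].
by apply/mem_set; rewrite /chosen_side; case: xgetP => [_ -> []//|/(_ h)].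
Qed.

(* the discrete spaces of sides of J, for all hyperplanes J *)
Definition orientations : topologicalType :=
  prod_topology (fun J : hyperplanes =>
    discrete_topology (set_type (sides (set_val J)))).

Definition orientation (a : ultrafilters) : orientations :=
  fun J : hyperplanes => exist _ (chosen_side a (set_val J)) (chosen_side_subproof a J).

HB.instance Definition _ :=
  Topological.copy ultrafilters (initial_topology orientation).

Definition nonterminating : set ultrafilters :=
  [set a | forall h, set_val a h -> exists2 h', set_val a h' & h' `<` h].

Definition nonterminating_closure : set ultrafilters := closure nonterminating.

End HalfSpaces.
Arguments hyperplanes {R} X _.
Arguments half_spaces {R} X _.
Arguments nonterminating {R} X _.
Arguments nonterminating_closure {R} X _.

(* Main.v *)
Require Import Defs.
From mathcomp Require Import all_boot all_order all_algebra.
From mathcomp Require Import all_classical all_reals all_analysis.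
From mathcomp Require Import borel_hierarchy.

(* Density is immediate from the definition of B(X) as a closure. An ultrafilter
   is nonterminating iff for every hyperplane J it contains a half-space strictly
   inside the side of J that it chooses; each of these conditions is open, so it
   suffices that there are countably many hyperplanes. A cell meeting c contains
   a vertex of c, hence by local finiteness c meets finitely many cells; as X is
   connected, there are countably many cells. Finally a hyperplane is determined
   by any one of its midcubes: the cells in which two hyperplanes agree trace out
   a clopen part of each of them. *)

Import Order.TTheory GRing.Theory Num.Theory.
Import numFieldNormedType.Exports.

Local Open Scope classical_set_scope.
Local Open Scope ring_scope.

(** * Countable intersections of open sets *)

Lemma countable_is_subset1 {T : Type} (A : set T) : is_subset1 A -> countable A.
Proof.
move=> A1; have [->|/set0P[x Ax]] := eqVneq A set0; first exact: countable0.
by apply: sub_countable (countable1 x); apply: subset_card_le => y /(A1 _ _ Ax).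
Qed.

(** An injection of [D] into the naturals has fibres with at most one element, so the open set
    placed at index [n] is either a single [U i] or the whole space. *)
Lemma Gdelta_bigcap_countable {T : topologicalType} {I : Type} (D : set I)
    (U : I -> set T) :
  countable D -> (forall i, D i -> open (U i)) -> Gdelta (\bigcap_(i in D) U i).
Proof.
move=> /countable_injP[f finj] Uo.
exists (fun n => \bigcap_(i in D `&` f @^-1` [set n]) U i).
  move=> n; have [->|/set0P[i [Di fi]]] := eqVneq (D `&` f @^-1` [set n]) set0.
    by rewrite bigcap_set0; exact: openT.
  rewrite (_ : _ `&` _ = [set i]) ?bigcap_set1; first exact: Uo.
  apply/seteqP; split=> [j [Dj fj]|_ ->//].
  by apply: finj; rewrite ?inE// fi.
by apply/seteqP; split=> [x Ux n _ i [Di _]|x Ux i Di]; [exact: Ux|exact: (Ux (f i))].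
Qed.

(** * The weak topology and the number of cells *)

Section CubicalTopology.
Context {R : realType}.

Definition corner {n} (b : {ffun 'I_n -> bool}) : 'rV[R]_n := \row_i (b i)%:R.

Lemma unit_cube_corner n (b : {ffun 'I_n -> bool}) : unit_cube R n (corner b).
Proof. by move=> i; rewrite mxE ler0n lern1 leq_b1. Qed.

Lemma cube_face_corner n (p : 'I_n -> option bool) :
  exists b, @cube_face R n p (corner b).
Proof.
(* Free coordinates, where [p i = None], are set to 0. *)
exists [ffun i => p i == Some true]; split; first exact: unit_cube_corner.
by move=> i b; rewrite mxE ffunE => ->; case: b.
Qed.

Lemma midcube_nonempty n (i : 'I_n) : @midcube R n i !=set0.
Proof.
exists (const_mx 2^-1); split=> [j|]; rewrite mxE//.
by rewrite invr_ge0 ler0n invf_le1 ?ltr0n// ler1n.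
Qed.

Lemma closed_unit_cube n : closed (unit_cube R n).
Proof.
rewrite (_ : unit_cube R n =
    \bigcap_(i in setT) ((fun u : 'rV[R]_n => u 0 i) @^-1` `[0, 1])).
  apply: closed_bigI => i _; apply: preimage_closed; last exact: interval_closed.
  by move=> u _; exact: coord_continuous.
by apply/seteqP; split=> u uP i; have := uP i; rewrite /= in_itv/=; [|apply].
Qed.

Lemma closed_midcube n (i : 'I_n) : closed (@midcube R n i).
Proof.
rewrite (_ : @midcube R n i =
    unit_cube R n `&` ((fun u : 'rV[R]_n => u 0 i) @^-1` [set 2^-1])) //.
apply: closedI; first exact: closed_unit_cube.
apply: preimage_closed; last exact: closed_eq.
by move=> u _; exact: coord_continuous.
Qed.

Variable X : cubeComplex R.
Implicit Types (c : cell X) (J : set X).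

(** Since [chart c] is injective on the unit cube, [F] is exactly the preimage of [A] that the weak
    topology tests. *)
Lemma closed_cellwise (A : set X) :
  (forall c, cube c `&` A = set0 \/
    exists F, [/\ closed F, F `<=` unit_cube R (Defs.dim c) &
      cube c `&` A = chart c @` F]) -> closed A.
Proof.
move=> AF; apply/weak_topologyE => c.
have chartA u : unit_cube R (Defs.dim c) u -> A (chart c u) ->
  (cube c `&` A) (chart c u) by split=> //; exists u.
have [A0|[F [Fcl Fc AE]]] := AF c.
  rewrite (_ : _ `&` _ = set0); first exact: closed0.
  by apply/seteqP; split=> // u [cu /(chartA _ cu)]; rewrite A0.
rewrite (_ : _ `&` _ = F)//; apply/seteqP; split=> u.
  by move=> [cu /(chartA _ cu)]; rewrite AE => -[v Fv /chart_inj <-//]; exact: Fc.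
move=> Fu; split; first exact: Fc.
by have [] : (cube c `&` A) (chart c u) by rewrite AE; exists u.
Qed.

(** The intersection is a face of [c], and every face contains a corner. *)
Lemma cube_corner c c' : cube c `&` cube c' !=set0 ->
  exists b, cube c' (chart c (corner b)).
Proof.
move=> [x xK]; have [K0|[p [p' [Kp _]]]] := cells_meet c c'.
  by move: xK; rewrite /cube K0.
have [b pb] := cube_face_corner _ p; exists b.
have : (chart c @` cube_face p) (chart c (corner b)) by exists (corner b).
by rewrite -Kp => -[].
Qed.

Hypothesis lfX : locally_finite X.

Lemma finite_cells_at (x : X) : finite_set [set c | cube c x].
Proof.
have [U xU] := lfX x; apply: sub_finite_set => c cx.
by exists x; split=> //; exact: nbhs_singleton.
Qed.

Lemma countable_neighbours c : countable [set c' | cube c `&` cube c' !=set0].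
Proof.
apply: (@sub_countable _ _ _
  (\bigcup_(b in [set: {ffun 'I_(Defs.dim c) -> bool}])
     [set c' | cube c' (chart c (corner b))])).
  by apply: subset_card_le => c' /cube_corner[b cb]; exists b.
apply: bigcup_countable => [|b _]; first exact: countableP.
exact/finite_set_countable/finite_cells_at.
Qed.

(** Balls of the graph in which two cells are adjacent when they meet. *)
Fixpoint gallery_ball c (n : nat) : set (cell X) :=
  if n is m.+1 then
    \bigcup_(c1 in gallery_ball c m) [set c2 | cube c1 `&` cube c2 !=set0]
  else [set c].

Lemma countable_gallery_ball c n : countable (gallery_ball c n).
Proof.
elim: n => [|n IHn] /=; first exact: countable1.
by apply: bigcup_countable => // c1 _; exact: countable_neighbours.
Qed.

(** By stability each cell lies inside the union or misses it. *)
Lemma closed_union_cells (S : set (cell X)) :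
  (forall c c', S c -> cube c `&` cube c' !=set0 -> S c') ->
  closed (\bigcup_(c in S) cube c).
Proof.
move=> Sstable; apply: closed_cellwise => c.
have [Sc|nSc] := pselect (S c).
  right; exists (unit_cube R (Defs.dim c)); split=> //; first exact: closed_unit_cube.
  by apply/seteqP; split=> [x []//|x cx]; split=> //; exists c.
left; apply/seteqP; split=> // x [cx].
by move=> [c' Sc' c'x]; apply: nSc; apply: (Sstable c') => //; exists x.
Qed.

Lemma countable_cells : connected [set: X] -> countable [set: cell X].
Proof.
move=> cX.
have [->|/set0P[c0 _]] := eqVneq [set: cell X] set0; first exact: countable0.
pose S := \bigcup_(n in [set: nat]) gallery_ball c0 n.
suff -> : [set: cell X] = S.
  by apply: bigcup_countable => [|n _]; [exact: countableP|exact: countable_gallery_ball].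
have Sstable c c' : S c -> cube c `&` cube c' !=set0 -> S c'.
  by move=> [n _ nc] cc'; exists n.+1 => //=; exists c.
have chart0 c : cube c (chart c (corner [ffun=> false])).
  by exists (corner [ffun=> false]); first exact: unit_cube_corner.
have unionE : \bigcup_(c in S) cube c = ~` \bigcup_(c in ~` S) cube c.
  apply/seteqP; split=> [x [c Sc cx] [c' nSc' c'x]|x nx].
    by apply: nSc'; apply: (Sstable c) => //; exists x.
  have [c cx] := cells_cover x; exists c => //.
  by apply: contrapT => nSc; apply: nx; exists c.
(* [S] and its complement are both stable under meeting, so this nonempty union is clopen. *)
have US : \bigcup_(c in S) cube c = setT.
  apply: cX; first by eexists; exists c0; [exists 0%N|exact: chart0].
    exists (\bigcup_(c in S) cube c); last by rewrite setTI.
    rewrite unionE; apply/closed_openC/closed_union_cells => c c' nSc cc' Sc'.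
    by apply: nSc; apply: (Sstable c') => //; rewrite setIC.
  exists (\bigcup_(c in S) cube c); last by rewrite setTI.
  exact: closed_union_cells.
apply/seteqP; split=> // c _.
have : (\bigcup_(c in S) cube c) (chart c (corner [ffun=> false])) by rewrite US.
by move=> [c' Sc' c'x]; apply: (Sstable c') => //; eexists; split; [exact: c'x|].
Qed.

End CubicalTopology.

(** Images of paths from [x0] are connected, share [x0] and cover [T]. *)
Lemma simply_connected_connected {R : realType} {T : topologicalType} :
  simply_connected R T -> connected [set: T].
Proof.
move=> [[x0 _] pathT _].
have -> : [set: T] = \bigcup_(A in [set A | connected A /\ A x0]) A.
  apply/seteqP; split=> // y _; have [g [gc g0 g1]] := pathT x0 y.
  exists (g @` `[0, 1]).
    split; first by apply: connected_continuous_connected => //; exact: segment_connected.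
    by exists 0; rewrite //= in_itv/= lexx ler01.
  by exists 1; rewrite //= in_itv/= lexx ler01.
by apply: bigcup_connected => [|A []//]; exists x0 => A [].
Qed.

(** * A hyperplane is determined by one midcube *)

Section Hyperplanes.
Context {R : realType} {X : cubeComplex R}.
Implicit Types (c : cell X) (J : set X).

(** If the traces in [c'] were midcubes in directions [i <> j], sliding [x] along [j] within the
    common face would stay in [J] but leave [J'], against the agreement in [c]. *)
Lemma hyperplanes_agree_adjacent J J' x c c' :
  hyperplanes X J -> hyperplanes X J' -> J x -> cube c x -> cube c' x ->
  cube c `&` J = cube c `&` J' -> cube c' `&` J = cube c' `&` J'.
Proof.
move=> [_ _ Jmid] [_ _ J'mid] Jx cx c'x JJ'.
have [_ J'x] : (cube c `&` J') x by rewrite -JJ'.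
have [J0|[i Ji]] := Jmid c'.
  by have : (cube c' `&` J) x by []; rewrite J0.
have [J'0|[j J'j]] := J'mid c'.
  by have : (cube c' `&` J') x by []; rewrite J'0.
have [ij|/eqP ij] := pselect (i = j); first by rewrite Ji J'j ij.
have [K0|[_ [p [_ Kp]]]] := cells_meet c c'.
  by have : (cube c `&` cube c') x by []; rewrite /cube K0.
have [u [ucube ui] ux] : (chart c' @` midcube i) x by rewrite -Ji.
have [v [vcube vj] vx] : (chart c' @` midcube j) x by rewrite -J'j.
have [w [wcube wp] wx] : (chart c' @` cube_face p) x by rewrite -Kp.
have uv : u = v by apply: chart_inj => //; rewrite ux vx.
have uw : u = w by apply: chart_inj => //; rewrite ux wx.
(* The [j]-th coordinate of the point is 1/2, so the face cannot fix it at 0 or 1. *)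
have pj : p j = None.
  case pjE : (p j) => [b|//]; have := wp _ _ pjE; rewrite -uw uv vj.
  case: b {pjE} => /= /eqP; rewrite ?invr_eq1 ?invr_eq0 ?pnatr_eq0//.
  by rewrite (eqr_nat R 2 1).
(* moving [x] across [J'] inside the common face, parallel to [J] *)
pose z := \row_k (if k == j then 0 else u 0 k) : 'rV[R]_(Defs.dim c').
have zcube : unit_cube R (Defs.dim c') z.
  by move=> k; rewrite mxE; case: ifP => // _; rewrite lexx ler01.
have zi : midcube i z by split; rewrite // mxE (negbTE ij).
have zp : cube_face p z.
  split=> // k b pk; rewrite mxE; case: eqP => [kj|_]; first by rewrite kj pj in pk.
  by rewrite uw; exact: wp.
have [cz c'z] : (cube c `&` cube c') (chart c' z) by rewrite /cube Kp; exists z.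
have [_ Jz] : (cube c' `&` J) (chart c' z) by rewrite Ji; exists z.
have [_ J'z] : (cube c `&` J') (chart c' z) by rewrite -JJ'.
have : (cube c' `&` J') (chart c' z) by [].
rewrite J'j => -[y [ycube yj] yz].
have yE : y = z by apply: chart_inj.
by move: yj; rewrite yE mxE eqxx => /esym/eqP; rewrite invr_eq0 pnatr_eq0.
Qed.

(** In a cell satisfying [P] the set is the whole trace of [J], empty or a midcube; in any other
    cell it is empty, as [P] would propagate. *)
Lemma hyperplane_closed_cells J (P : set (cell X)) : hyperplanes X J ->
  (forall x c c', J x -> cube c x -> cube c' x -> P c -> P c') ->
  closed [set x | J x /\ exists2 c, cube c x & P c].
Proof.
move=> [_ _ Jmid] Padj; apply: closed_cellwise => c.
have [[Pc|nPc] [J0|[i Ji]]] := (pselect (P c), Jmid c).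
- left; apply/seteqP; split=> // x [cx [Jx _]].
  by rewrite -J0.
- right; exists (midcube i); split; [exact: closed_midcube|by move=> u []|].
  rewrite -Ji; apply/seteqP; split=> x [cx]; first by case.
  by move=> Jx; split=> //; split=> //; exists c.
- left; apply/seteqP; split=> // x [cx [Jx _]].
  by rewrite -J0.
- left; apply/seteqP; split=> // x.
  by move=> [cx [Jx [c' c'x Pc']]]; apply: nPc; exact: (Padj x c').
Qed.

Lemma hyperplane_sub_of_agree J J' c :
  hyperplanes X J -> hyperplanes X J' -> cube c `&` J !=set0 ->
  cube c `&` J = cube c `&` J' -> J `<=` J'.
Proof.
move=> hJ hJ' [x0 [cx0 Jx0]] JJ'.
pose P := [set c1 | cube c1 `&` J = cube c1 `&` J'].
have Padj x c1 c2 : J x -> cube c1 x -> cube c2 x -> P c1 -> P c2.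
  exact: hyperplanes_agree_adjacent.
pose A := [set x | J x /\ exists2 c, cube c x & P c].
have AJ : A = J.
  have [_ Jconn _] := hJ; apply: Jconn.
  - by exists x0; split=> //; exists c.
  (* [A] is open in [J]: its complement there is the closed set traced by the cells of disagreement,
     which propagates because agreement does. *)
  - exists (~` [set x | J x /\ exists2 c, cube c x & (~` P) c]).
      apply/closed_openC/hyperplane_closed_cells => // x c1 c2 Jx c1x c2x nP1 P2.
      by apply: nP1; exact: (Padj x c2).
    apply/seteqP; split=> x.
      move=> [Jx [c1 c1x Pc1]]; split=> // -[_ [c2 c2x]]; apply.
      exact: (Padj x c1).
    move=> [Jx nx]; split=> //; have [c1 c1x] := cells_cover x; exists c1 => //.
    by apply: contrapT => nPc1; apply: nx; split=> //; exists c1.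
  - exists A; first exact: hyperplane_closed_cells.
    by apply/seteqP; split=> x => [[Jx Ax]|[]].
rewrite -AJ => x [Jx [c1 c1x Pc1]].
by have [] : (cube c1 `&` J') x by rewrite -Pc1.
Qed.

(** Pairs of a cell and a direction index a countable cover of the hyperplanes by sets with at most
    one element. *)
Lemma countable_hyperplanes :
  countable [set: cell X] -> countable (hyperplanes X).
Proof.
move=> cellsX.
pose H c (i : 'I_(Defs.dim c)) :=
  [set J | hyperplanes X J /\ cube c `&` J = chart c @` midcube i].
apply: (@sub_countable _ _ _
  (\bigcup_(c in [set: cell X]) \bigcup_(i in [set: 'I_(Defs.dim c)]) H c i)).
  apply: subset_card_le => J hJ; have [[x Jx] _ Jmid] := hJ.
  have [c cx] := cells_cover x; exists c => //; have [J0|[i Ji]] := Jmid c.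
    by have : (cube c `&` J) x by []; rewrite J0.
  by exists i.
apply: bigcup_countable => // c _; apply: bigcup_countable => [|i _].
  exact: countableP.
apply: countable_is_subset1 => J J' [hJ Ji] [hJ' J'i].
have c0 : chart c @` midcube i !=set0.
  by have [u iu] := @midcube_nonempty R _ i; exists (chart c u); exists u.
by apply/seteqP; split; apply: (@hyperplane_sub_of_agree _ _ c); rewrite ?Ji ?J'i.
Qed.

End Hyperplanes.

(** * Nontermination as a family of open conditions *)

Section Ultrafilters.
Context {R : realType} {X : cubeComplex R}.
Implicit Types (a : ultrafilters X) (J h : set X).

Lemma chosen_sideP a J : hyperplanes X J ->
  sides J (chosen_side a J) /\ set_val a (chosen_side a J).
Proof.
move=> hJ; have [_ + _] := set_valP a.
move=> /(_ _ hJ)[h [hP _]].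
by rewrite /chosen_side; case: xgetP => [_ -> //|/(_ h)].
Qed.

Lemma chosen_side_unique a J h : hyperplanes X J -> sides J h -> set_val a h ->
  chosen_side a J = h.
Proof.
move=> hJ Jh ah; have [_ /(_ _ hJ)[k [_ kuniq]] _] := set_valP a.
by rewrite -(kuniq h)// -(kuniq (chosen_side a J))//; exact: chosen_sideP.
Qed.

(** The choice at [J] is a coordinate of [orientation] with values in a discrete space. *)
Lemma open_chosen_side J h : hyperplanes X J ->
  open [set a : ultrafilters X | chosen_side a J = h].
Proof.
move=> hJ; pose j : hyperplanes X := exist _ J (mem_set hJ).
pose Y (i : hyperplanes X) := discrete_topology (set_type (sides (set_val i))).
have -> : [set a : ultrafilters X | chosen_side a J = h] =
    @orientation R X @^-1` (@proj _ Y j @^-1` [set s | set_val s = h]) by [].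
apply: open_comp; first by move=> a _; exact: initial_continuous.
apply: open_comp; first by move=> a _; exact: proj_continuous.
exact: discrete_open.
Qed.

(** Nontermination tested at [J] alone; indexing by hyperplanes gives a condition on every
    ultrafilter. *)
Definition refinable J : set (ultrafilters X) :=
  [set a | exists2 h, set_val a h & h `<` chosen_side a J].

Lemma open_refinable J : hyperplanes X J -> open (refinable J).
Proof.
move=> hJ; rewrite openE => a [h ah hJa].
(* The witness [h] is a side of some [J']; keeping the choices at [J] and [J'] keeps the witness. *)
have [/(_ _ ah)[J' hJ' J'h] _ _] := set_valP a.
apply: (@filterS _ _ _ ([set b | chosen_side b J = chosen_side a J] `&`
                        [set b | chosen_side b J' = h])).
  move=> b [/= bJ bJ']; exists h; last by rewrite bJ.
  by have [_] := chosen_sideP b _ hJ'; rewrite bJ'.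
apply: open_nbhs_nbhs; split; first by apply: openI; exact: open_chosen_side.
by split=> //=; exact: chosen_side_unique.
Qed.

(** The members of an ultrafilter are exactly the sides it chooses. *)
Lemma nonterminatingE :
  nonterminating X = \bigcap_(J in hyperplanes X) refinable J.
Proof.
apply/seteqP; split=> a aP.
  by move=> J hJ; have [_ /aP[h]] := chosen_sideP a _ hJ; exists h.
move=> h ah; have [/(_ _ ah)[J hJ Jh] _ _] := set_valP a.
by have [h' ah'] := aP _ hJ; rewrite (chosen_side_unique a _ _ hJ Jh ah); exists h'.
Qed.

End Ultrafilters.

(** * Passage to the subspace B(X) *)

Lemma Gdelta_preimage {S T : topologicalType} (f : S -> T) (A : set T) :
  continuous f -> Gdelta A -> Gdelta (f @^-1` A).
Proof.
move=> fc [F Fo ->]; exists (fun n => f @^-1` F n); last by rewrite preimage_bigcap.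
by move=> n; apply: open_comp => // x _; exact: fc.
Qed.

(** A nonempty open set of the subspace is the trace of an open [V] containing a point of the
    closure, so [V] meets [A]. *)
Lemma dense_in_closure {T : topologicalType} (A : set T) :
  dense [set b : set_type (closure A) | A (set_val b)].
Proof.
move=> O [b Ob] [V Vo VO]; have Vb : V (set_val b) by rewrite -VO in Ob.
have [a [Aa Va]] := set_valP b V (open_nbhs_nbhs (conj Vo Vb)).
exists (exist _ a (mem_set (subset_closure Aa))); split=> //.
by rewrite -VO.
Qed.

(* [set_type B] carries the subspace topology of B(X). *)
Theorem proposition3p4 (R : realType) (X : cubeComplex R) :
  CAT0 X -> unbounded X -> locally_finite X -> finite_dimensional X ->
  essential X -> strictly_nonEuclidean X -> cocompact X ->
  let B := nonterminating_closure X in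
  [/\ nonterminating X `<=` B,
      dense ([set b : set_type B | nonterminating X (set_val b)]) &
      Gdelta ([set b : set_type B | nonterminating X (set_val b)])].
Proof.
move=> [scX _] _ lfX _ _ _ _ B; split.
- exact: subset_closure.
- exact: dense_in_closure.
(* The subspace topology is initial for [set_val], so it suffices to work among all ultrafilters. *)
- apply: (@Gdelta_preimage _ _ (set_val : set_type B -> ultrafilters X)).
    exact: initial_continuous.
  rewrite nonterminatingE; apply: Gdelta_bigcap_countable; last exact: open_refinable.
  apply: countable_hyperplanes; apply: countable_cells => //.
  exact: simply_connected_connected scX.
Qed.
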